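(* Let $V$ be a finite dimensional $\mathbb{F}_q$-vector space, $V'\subset V$ an $\mathbb{F}_q$-subspace, $R$ a commutative $\mathbb{F}_q$-algebra, and $\rho\colon V\setminus\{0\}\to R$ an $\mathbb{F}_q$-reciprocal map. For any $v\in V\setminus V'$ we have (a) $\displaystyle\Bigl(\sum_{v'\in V'}\rho(v-v')\Bigr)\cdot\Bigl(\prod_{v'\in V'\setminus\{0\}}\rho(v')\Bigr)=\prod_{v'\in V'}\rho(v-v')$; (b) $\displaystyle\Bigl(\sum_{v'\in V'}\rho(v-v')\Bigr)\cdot\Bigl(\prod_{v'\in V'\setminus\{0\}}\bigl(\rho(v)-\rho(v')\bigr)\Bigr)=\rho(v)^{|V'|}$; (c) $\displaystyle\Bigl(\sum_{v'\in V'}\rho(v-v')\Bigr)\cdot e_{\rho|V'}\Bigl(\frac{1}{\rho(v)}\Bigr)=1$ if $\rho(v)\in R^\times$, where $e_{\rho|V'}(X)=X\cdot\prod_{v'\in V'\setminus\{0\}}(1-\rho(v')X)\in R[X]$.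
   Context: $\mathbb{F}_q$ is a finite field with $q$ elements. A map $\rho\colon V\setminus\{0\}\to R$ is called $\mathbb{F}_q$-reciprocal if $\rho(v)\rho(w)=\rho(v+w)(\rho(v)+\rho(w))$ for all $v,w\in V\setminus\{0\}$ with $v+w\neq0$, and $\alpha\rho(\alpha v)=\rho(v)$ for all $\alpha\in\mathbb{F}_q^\times$ and $v\in V\setminus\{0\}$. *)

(* Defs.v *)
From mathcomp Require Import all_boot all_order all_algebra all_field.

Set Implicit Arguments.
Unset Strict Implicit.
Unset Printing Implicit Defensive.

Import GRing.Theory.
Local Open Scope ring_scope.

(* A map V \ {0} -> R is encoded as a total function V -> R whose value at 0
   is arbitrary: no definition below ever constrains or uses rho 0. *)
Definition reciprocal (F : finFieldType) (V : vectType F) (R : comAlgType F)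
    (rho : V -> R) : Prop :=
  (forall v w : V, v != 0 -> w != 0 -> v + w != 0 ->
     rho v * rho w = rho (v + w) * (rho v + rho w))
  /\ (forall (a : F) (v : V), a != 0 -> v != 0 -> a *: rho (a *: v) = rho v).

(* [finvect_type V] is V itself, viewed as a finite type. *)
Definition e_poly (F : finFieldType) (V : vectType F) (R : comAlgType F)
    (rho : V -> R) (W : {vspace V}) : {poly R} :=
  'X * \prod_(w : finvect_type V | (w \in W) && (w != 0)) (1 - (rho w)%:P * 'X).

(* Main.v *)
(* Reading rho as v |-> 1/v, the product of the factors y - x rho(u - t) over
   a finite set of points t is a rational function of u with simple poles at
   these points, so it has a partial fraction expansion; reciprocity of rho is
   exactly what proves that expansion over an arbitrary ring.  For the points of
   a subspace all residues agree, by translation.  The three claims are the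
   cases (x, y) = (-1, 0), (1, rho v) and (1 / rho v, 1); in the last two the
   factor at t = 0 kills the product. *)
Require Import Defs.
From mathcomp Require Import all_boot all_order all_algebra all_field.
From mathcomp Require Import ring.
Import GRing.Theory.
Local Open Scope ring_scope.

Section Reciprocal.

Context {F : finFieldType} {V : vectType F} {R : comAlgType F}.
Context {rho : V -> R} (hrho : reciprocal rho).

Lemma reciprocalN (v : V) : v != 0 -> rho (- v) = - rho v.
Proof.
move=> v0; case: hrho => _ /(_ (-1) v); rewrite oppr_eq0 oner_eq0.
by move=> /(_ isT v0) <-; rewrite !scaleN1r opprK.
Qed.

(** This is reciprocity for [u - t] and [- (u - s)], whose sum [s - t] does not involve [u]. *)
Lemma reciprocal_partial_fraction2 (u s t : V) : u != s -> u != t -> s != t ->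
  rho (u - t) * rho (u - s)
  = rho (u - s) * rho (s - t) + rho (u - t) * rho (t - s).
Proof.
move=> us ut st.
have us0 : u - s != 0 by rewrite subr_eq0.
have st0 : s - t != 0 by rewrite subr_eq0.
have eq_st : (u - t) + - (u - s) = s - t.
  by rewrite opprB addrC addrA subrK.
have := hrho.1 (u - t) (- (u - s)).
rewrite eq_st subr_eq0 oppr_eq0 reciprocalN // => /(_ ut us0 st0).
rewrite -(opprB s t) reciprocalN // mulrN => E.
by rewrite -[LHS]opprK E; ring.
Qed.

(** Heuristically, [y ^+ size s] is the value at infinity, where every [rho (u - t)] vanishes, and
    the residue at [t] is [- x] times the remaining factors evaluated at [u = t]. The induction adds
    one pole at a time. *)
Lemma reciprocal_partial_fraction (x y : R) (u : V) (s : seq V) :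
  uniq s -> u \notin s ->
  \prod_(t <- s) (y - x * rho (u - t))
  = y ^+ size s - x * \sum_(t <- s)
      rho (u - t) * \prod_(t' <- s | t' != t) (y - x * rho (t - t')).
Proof.
elim: s u => [|a s IH] u; first by rewrite !big_nil mulr0 subr0.
rewrite inE negb_or /= => /andP[a_s s_uniq] /andP[ua us].
rewrite !big_cons eqxx /= IH //.
have -> : \prod_(t' <- s | t' != a) (y - x * rho (a - t'))
        = \prod_(t' <- s) (y - x * rho (a - t')).
  rewrite big_seq_cond [RHS]big_seq_cond; apply: eq_bigl => t /=.
  by case: (boolP (t \in s)) => //= ts; rewrite (memPn a_s).
(* The residue at the new pole [a] is the old product at [u = a], so the induction hypothesis is
   needed there too; hence [u] is generalized. *)
rewrite (IH a) //.
set B := fun t => \prod_(t' <- s | t' != t) (y - x * rho (t - t')).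
(* Each old residue gains the factor [y - x * rho (t - a)]; the two-pole identity trades
   [rho (u - t) * rho (t - a)] for multiples of [rho (u - a)]. *)
have -> : \sum_(t <- s) rho (u - t)
            * \prod_(t' <- a :: s | t' != t) (y - x * rho (t - t'))
        = y * (\sum_(t <- s) rho (u - t) * B t)
          - x * (rho (u - a) * (\sum_(t <- s) rho (u - t) * B t)
                 - rho (u - a) * (\sum_(t <- s) rho (a - t) * B t)).
  rewrite !mulr_sumr -sumrB mulr_sumr -sumrB big_seq [RHS]big_seq.
  apply: eq_bigr => t ts.
  have ta : t != a by rewrite (memPn a_s).
  have ut : u != t by apply: contraNneq us => ->.
  rewrite big_cons eq_sym ta -/(B t).
  have := reciprocal_partial_fraction2 u t a ut ua ta => E.
  by rewrite !mulrA E; ring.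
rewrite exprS -/(B _); ring.
Qed.

Lemma reciprocal_subspace_expansion (x y : R) (W : {vspace V}) (v : V) :
  v \notin W ->
  \prod_(w : finvect_type V | w \in W) (y - x * rho (v - w))
  = y ^+ #|[pred w : finvect_type V | w \in W]|
    - x * (\sum_(w : finvect_type V | w \in W) rho (v - w))
      * \prod_(w : finvect_type V | (w \in W) && (w != 0)) (y - x * rho w).
Proof.
move=> vW; set s := enum [pred w : finvect_type V | w \in W].
have vs : (v : finvect_type V) \notin s by rewrite mem_enum.
have : \prod_(t <- s) (y - x * rho (v - t))
     = y ^+ size s - x * \sum_(t <- s)
         rho (v - t) * \prod_(t' <- s | t' != t) (y - x * rho (t - t')).
  exact: (reciprocal_partial_fraction x y v s (enum_uniq _) vs).
rewrite /s -cardE !big_enum /= => ->; congr (_ - _).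
rewrite -mulrA mulr_suml; congr (_ * _); apply: eq_bigr => w wW.
congr (_ * _); rewrite big_enum_cond /=.
(* The substitution [t' = w - t] preserves [W] and turns [t' != w] into [t != 0], so the residue no
   longer depends on [w]. *)
rewrite (reindex_inj (inj_comp (addrI w) oppr_inj)) /=.
apply: eq_big => [t|t _]; last by rewrite opprB addrCA subrr addr0.
rewrite inE; have -> : (w - t \in W) = (t \in W) by exact: (@rpredBl V W).
by rewrite -subr_eq0 addrAC subrr sub0r oppr_eq0.
Qed.

End Reciprocal.

Theorem proposition1p3p4 (F : finFieldType) (V : vectType F) (V' : {vspace V})
    (R : comAlgType F) (rho : V -> R) (hrho : reciprocal rho)
    (v : V) (hv : v \notin V') :
  [/\ (* (a) *)
      (\sum_(v' : finvect_type V | v' \in V') rho (v - v'))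
        * (\prod_(v' : finvect_type V | (v' \in V') && (v' != 0)) rho v')
      = \prod_(v' : finvect_type V | v' \in V') rho (v - v'),
      (* (b) *)
      (\sum_(v' : finvect_type V | v' \in V') rho (v - v'))
        * (\prod_(v' : finvect_type V | (v' \in V') && (v' != 0))
             (rho v - rho v'))
      = rho v ^+ #|[pred v' : finvect_type V | v' \in V']|
    & (* (c), with u = 1 / rho v *)
      forall u : R, rho v * u = 1 ->
        (\sum_(v' : finvect_type V | v' \in V') rho (v - v'))
          * (e_poly rho V').[u] = 1].
Proof.
have expansion x y := reciprocal_subspace_expansion hrho x y V' v hv.
have prod0 x y : y - x * rho v = 0 ->
    \prod_(w : finvect_type V | w \in V') (y - x * rho (v - w)) = 0.
  move=> E; rewrite (bigD1 (0 : finvect_type V)) /=; last exact: mem0v.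
  by rewrite subr0 E mul0r.
split.
- have negE (r : R) : 0 - -1 * r = r by rewrite mulN1r sub0r opprK.
  have := expansion (-1) 0; rewrite expr0n.
  (* The constant term [0 ^+ #|V'|] vanishes only because the exponent is positive. *)
  have /negPf-> : #|[pred w : finvect_type V | w \in V']| != 0%N.
    by apply/pred0Pn; exists 0; rewrite inE; exact: mem0v.
  rewrite -mulrA negE.
  rewrite (eq_bigr _ (fun w _ => negE (rho (v - w)))) => ->.
  by rewrite (eq_bigr _ (fun w _ => negE (rho w))).
- have := expansion 1 (rho v).
  rewrite prod0 ?mul1r ?subrr // => /esym/subr0_eq->.
  by congr (_ * _); apply: eq_bigr => w _; rewrite mul1r.
- move=> u vu; have := expansion u 1; rewrite prod0 => [|]; last first.
    by rewrite mulrC vu subrr.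
  rewrite expr1n => /esym/subr0_eq->.
  (* The coefficient [x = u] of the expansion supplies the leading factor ['X] of [e_poly]. *)
  rewrite /e_poly hornerM hornerX horner_prod mulrCA mulrA.
  by congr (_ * _); apply: eq_bigr => w _; rewrite !hornerE mulrC.
Qed.
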